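(* Let $J\subset\mathbb R$ be an interval, let $\alpha_1,\dots,\alpha_m\colon J\to\mathbb R$ be continuous functions linearly independent on $J$, let $A_1,\dots,A_m$ be pairwise commuting real constant $n\times n$ matrices, and let $B_j=A_j^{T}$, $j=1,\dots,m$. Let $\zeta\in\{1,\dots,m\}$ and let the following conditions hold: (i) $\nu^{0}$ is a common eigenvector of the matrices $B_j$ corresponding to the eigenvalues $\lambda^{j}$, $j=1,\dots,m$; (ii) $\nu^{\theta}$, $\theta=1,\dots,s-1$, are generalized eigenvectors (of order $\theta$) of the matrix $B_\zeta$ corresponding to the eigenvalue $\lambda^{\zeta}$ with elementary divisor of multiplicity $s\geq2$; (iii) the linear differential system $\dfrac{dx}{dt}=A_\zeta x$ has no first integrals of the form $$F^{\zeta}_{j\theta}\colon x\mapsto\mathfrak a_j\Psi^{\zeta}_\theta(x)\quad\text{for all }x\in\mathscr X,\quad j=1,\dots,m,\ j\neq\zeta,\quad\theta=1,\dots,s-1.$$ Here $\mathscr X$ is a domain contained in $\{x\in\mathbb R^n\colon\nu^{0}x\neq0\}$, and the functions $\Psi^{\zeta}_\theta\colon\mathscr X\to\mathbb R$, $\theta=1,\dots,s-1$, are the solution of the functional system $$\nu^{\theta}x=\sum_{\rho=1}^{\theta}\binom{\theta-1}{\rho-1}\Psi^{\zeta}_\rho(x)\,\nu^{\theta-\rho}x\quad\text{for all }x\in\mathscr X,\quad\theta=1,\dots,s-1.$$ Then the Lappo-Danilevskii system $\dfrac{dx}{dt}=\sum_{j=1}^{m}\alpha_j(t)A_jx$ has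 the first integrals $$F_\theta\colon(t,x)\mapsto\Psi^{\zeta}_\theta(x)-\int_{t_0}^{t}\sum_{j=1}^{m}\mu^{j\zeta}_\theta\,\alpha_j(\tau)\,d\tau\quad\text{for all }(t,x)\in J\times\mathscr X,\quad\theta=1,\dots,s-1,$$ where $t_0$ is a fixed point of the interval $J$ and $\mu^{j\zeta}_\theta=\mathfrak a_j\Psi^{\zeta}_\theta(x)$, $x\in\mathscr X$, $j=1,\dots,m$, $\theta=1,\dots,s-1$, which are constants under conditions (i)-(iii) (with $\mu^{\zeta\zeta}_1=1$ and $\mu^{\zeta\zeta}_\theta=0$ for $\theta=2,\dots,s-1$).
   Context: A domain is an open arcwise connected set. For a vector $\nu=(\nu_1,\dots,\nu_n)$ and $x\in\mathbb R^n$, $\nu x=\sum_{\xi=1}^n\nu_\xi x_\xi$; vectors are regarded as columns when multiplied by $B_j$. The operators are $\mathfrak a_j=\sum_{\xi=1}^n(A_jx)_\xi\,\partial_{x_\xi}$, $j=1,\dots,m$. Given an eigenvector $\nu^0$ of $B_\zeta$ with eigenvalue $\lambda^\zeta$ with elementary divisor of multiplicity $s$, generalized eigenvectors $\nu^{\theta}$ of order $\theta$ are non-zero vectors in $\mathbb C^n$ satisfying $(B_\zeta-\lambda^{\zeta}E)\nu^{\theta}=\theta\,\nu^{\theta-1}$, $\theta=1,\dots,s-1$, where $E$ is the identity matrix. A first integral of $dx/dt=X(t,x)$ on a domain $G'$ is a continuously differentiable function $F\colon G'\to\mathbb R$ with $\partial_tF+\sum_{\xi=1}^nX_\xi\,\partial_{x_\xi}F=0$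 on $G'$ (for a function $F(x)$ and the system $dx/dt=A_\zeta x$ this reads $\mathfrak a_\zeta F=0$). The result is also used for complex eigenvectors; then the functions $\Psi^{\zeta}_\theta$ and $F_\theta$ are complex-valued, and the real and imaginary parts of $F_\theta$ are real first integrals. *)

(* Defs.v *)
From HB Require Import structures.
From mathcomp Require Import all_boot all_order all_algebra.
From mathcomp Require Import all_classical all_reals all_analysis.
From mathcomp Require Import complex.

Set Implicit Arguments.
Unset Strict Implicit.
Unset Printing Implicit Defensive.

Import Order.TTheory GRing.Theory Num.Theory numFieldNormedType.Exports.

Local Open Scope classical_set_scope.
Local Open Scope ring_scope.

(** The k-th determinantal divisor of a polynomial matrix is the gcd of its
    k x k minors. Index maps [f], [g] that are not injective give the zero
    minor, and reordering rows or columns only changes a sign, so letting them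
    range over all maps does not change the gcd. *)
Definition det_divisor (K : fieldType) (n : nat) (M : 'M[{poly K}]_n)
    (k : nat) : {poly K} :=
  \big[@gcdp K/0]_(f : {ffun 'I_k -> 'I_n})
    \big[@gcdp K/0]_(g : {ffun 'I_k -> 'I_n}) \det (mxsub f g M).

Definition invariant_factor (K : fieldType) (n : nat) (B : 'M[K]_n)
    (k : nat) : {poly K} :=
  det_divisor (char_poly_mx B) k %/ det_divisor (char_poly_mx B) k.-1.

(** [('X - l%:P) ^+ s] is one of the elementary divisors of [B]: it is the
    exact power of ['X - l%:P] occurring in some invariant factor. *)
Definition has_elementary_divisor (K : fieldType) (n : nat) (B : 'M[K]_n)
    (l : K) (s : nat) : Prop :=
  (0 < s)%N /\
  exists k : nat, (1 <= k <= n)%N /\ mup l (invariant_factor B k) = s.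

Definition arcwise_connected (T : topologicalType) (R : realType)
    (X : set T) : Prop :=
  forall x y : T, X x -> X y ->
    exists c : R -> T,
      [/\ {within `[0, 1]%classic, continuous c}, c 0 = x, c 1 = y &
          forall u : R, 0 <= u <= 1 -> X (c u)].

Definition is_domain (R : realType) (n : nat) (X : set 'cV[R]_n) : Prop :=
  open X /\ arcwise_connected R X.

(** [has_partial G F p v l]: the derivative of [F], as a function on the set
    [G], at [p] in the direction [v] is [l]. Only increments that stay in [G]
    are used: this is the usual derivative at interior points, and the
    one-sided one where [G] is [J `*` X] and [p.1] is an endpoint of [J]. *)
Definition has_partial (R : realType) (V : normedModType R) (G : set V)
    (F : V -> R) (p v : V) (l : R) : Prop :=
  (fun h : R => h^-1 * (F (p + h *: v) - F p))
    @ within [set h : R | G (p + h *: v)] (0 : R)^' --> l.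

Definition first_integral (R : realType) (n : nat) (G : set (R * 'cV[R]_n))
    (V : R -> 'cV[R]_n -> 'cV[R]_n) (F : R * 'cV[R]_n -> R) : Prop :=
  exists (Ft : R * 'cV[R]_n -> R) (Fx : 'I_n -> R * 'cV[R]_n -> R),
    [/\ {within G, continuous Ft},
        forall xi, {within G, continuous (Fx xi)},
        forall p, G p -> has_partial G F p (1, 0) (Ft p),
        forall p xi, G p -> has_partial G F p (0, delta_mx xi 0) (Fx xi p) &
        forall p, G p -> Ft p + \sum_(xi < n) V p.1 p.2 xi 0 * Fx xi p = 0].

(** A complex-valued function is a first integral when its real and imaginary
    parts are; real-valued functions are those with zero imaginary part. *)
Definition first_integralC (R : realType) (n : nat) (G : set (R * 'cV[R]_n))
    (V : R -> 'cV[R]_n -> 'cV[R]_n) (F : R * 'cV[R]_n -> R[i]) : Prop :=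
  first_integral G V (fun p => complex.Re (F p)) /\
  first_integral G V (fun p => complex.Im (F p)).

(** [f] is a non-constant first integral on [X] of the autonomous system
    [dx/dt = A x]. Constants satisfy the equation of first integrals for every
    system, so they do not count when a system is said to have no first
    integral of a given form. *)
Definition nonconst_autonomous_first_integral (R : realType) (n : nat)
    (X : set 'cV[R]_n) (A : 'M[R]_n) (f : 'cV[R]_n -> R[i]) : Prop :=
  first_integralC ([set: R] `*` X) (fun _ x => A *m x) (fun p => f p.2) /\
  exists x y : 'cV[R]_n, [/\ X x, X y & f x <> f y].

Definition cpartial (R : realType) (n : nat) (xi : 'I_n)
    (f : 'cV[R]_n -> R[i]) (x : 'cV[R]_n) : R[i] :=
  Complex ('D_(delta_mx xi 0) (fun y => complex.Re (f y)) x)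
          ('D_(delta_mx xi 0) (fun y => complex.Im (f y)) x).

Definition lie_op (R : realType) (n : nat) (A : 'M[R]_n)
    (f : 'cV[R]_n -> R[i]) (x : 'cV[R]_n) : R[i] :=
  \sum_(xi < n) real_complex R ((A *m x) xi 0) * cpartial xi f x.

(** [nu x = \sum_xi nu_xi x_xi], bilinear (no conjugation). *)
Definition linform (R : realType) (n : nat) (nu : 'cV[R[i]]_n)
    (x : 'cV[R]_n) : R[i] :=
  \sum_(xi < n) nu xi 0 * real_complex R (x xi 0).

Definition trmxC (R : realType) (n : nat) (A : 'M[R]_n) : 'M[R[i]]_n :=
  map_mx (real_complex R) A^T.

Definition lin_indep_on (R : realType) (m : nat) (J : set R)
    (alpha : 'I_m -> R -> R) : Prop :=
  forall c : 'I_m -> R,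
    (forall t, J t -> \sum_(j < m) c j * alpha j t = 0) ->
    forall j, c j = 0.

Definition oint (R : realType) (a b : R) (f : R -> R) : R :=
  if a <= b then \int[lebesgue_measure]_(u in `[a, b]) f u
  else - \int[lebesgue_measure]_(u in `[b, a]) f u.

Definition ointC (R : realType) (a b : R) (f : R -> R[i]) : R[i] :=
  Complex (oint a b (fun u => complex.Re (f u)))
          (oint a b (fun u => complex.Im (f u))).

(* Main.v *)
(** On [X] the functional system is triangular with diagonal entry [nu^0 x], so
    every [Psi_theta] lies in the algebra generated by the linear forms and
    [1 / nu^0 x].  The operators [a_j] act on this algebra as derivations, and
    commute because they do on linear forms.  Applying [a_zeta] to the
    functional system gives a triangular system for the [a_zeta Psi_theta]
    whose solution is [1, 0, ..., 0].  Hence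
    [a_zeta (a_j Psi_theta) = a_j (a_zeta Psi_theta) = 0]: each [a_j Psi_theta]
    is a first integral of [dx/dt = A_zeta x], thus constant by (iii).  The
    derivative of [Psi_theta] along the full system is then
    [\sum_j mu^j_theta alpha_j], which the integral term cancels. *)
Require Import Defs.
From HB Require Import structures.
From mathcomp Require Import all_boot all_order all_algebra.
From mathcomp Require Import all_classical all_reals all_analysis.
From mathcomp Require Import complex ring lra.
Import Order.TTheory GRing.Theory Num.Theory numFieldNormedType.Exports.
Local Open Scope classical_set_scope.
Local Open Scope ring_scope.
Set Implicit Arguments.
Unset Strict Implicit.
Unset Printing Implicit Defensive.

(** * Primitives of continuous functions on an interval *)

Section PrimitiveOnInterval.
Variables (R : realType) (J : set R) (f : R -> R).
Hypotheses (itvJ : is_interval J) (cf : {within J, continuous f}).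

Lemma integrable_segment a b : J a -> J b ->
  lebesgue_measure.-integrable `[a, b]%classic (EFin \o f).
Proof.
move=> Ja Jb; apply: continuous_compact_integrable; first exact: segment_compact.
apply: continuous_subspaceW cf => x /=; rewrite in_itv /= => xab.
exact: itvJ Ja Jb x xab.
Qed.

Lemma integral_segmentD a b c : J a -> J c -> a <= b -> b <= c ->
  \int[lebesgue_measure]_(u in `[a, c]) f u =
  \int[lebesgue_measure]_(u in `[a, b]) f u +
  \int[lebesgue_measure]_(u in `[b, c]) f u.
Proof.
move=> Ja Jc ab bc.
have Jb : J b by apply: itvJ Ja Jc _ _; rewrite ab.
have iac := integrable_segment Ja Jc.
have := Rintegral_itvB (x := b) iac.
rewrite !bnd_simp => /(_ ab bc) E.
(* The subtraction formula [E] produces the interval from [b] to [c] open at [b]; adding the single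
   point [b] leaves the integral unchanged. *)
rewrite -(Rintegral_itv_obnd_cbnd (r := b) (b := BRight c)).
  by rewrite -E addrC subrK.
by apply: integrableS (integrable_segment Jb Jc) => //; apply: subset_itvr; rewrite bnd_simp.
Qed.

(** Each order of [a], [b], [c] reduces to additivity on the longest segment, split at the middle
    point; two of the eight comparison patterns are contradictory. *)
Lemma ointD a b c : J a -> J b -> J c -> oint a c f = oint a b f + oint b c f.
Proof.
move=> Ja Jb Jc; rewrite /oint.
case: (leP a b) => ab; case: (leP b c) => bc; case: (leP a c) => ac.
- exact: integral_segmentD.
- by have := lt_le_trans ac (le_trans ab bc); rewrite ltxx.
- by rewrite (integral_segmentD Ja Jb ac (ltW bc)) addrK.
- by rewrite (integral_segmentD Jc Jb (ltW ac) ab); lra.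
- by rewrite (integral_segmentD Jb Jc (ltW ab) ac); lra.
- by rewrite (integral_segmentD Jb Ja bc (ltW ac)); lra.
- by have := lt_le_trans (lt_trans bc ab) ac; rewrite ltxx.
- by rewrite (integral_segmentD Jc Ja (ltW bc) (ltW ab)); lra.
Qed.

Lemma integral_segment_dist (a b c e : R) : J a -> J b -> a <= b ->
  (forall u, a <= u <= b -> `|c - f u| <= e) ->
  `|\int[lebesgue_measure]_(u in `[a, b]) f u - (b - a) * c| <= (b - a) * e.
Proof.
move=> Ja Jb ab fe.
have iab := integrable_segment Ja Jb.
have icst k : lebesgue_measure.-integrable `[a, b]%classic (EFin \o (fun _ : R => k)).
  apply: continuous_compact_integrable; first exact: segment_compact.
  by apply: continuous_subspaceT => x; exact: cvg_cst.
have Icst k : \int[lebesgue_measure]_(u in `[a, b]) (fun _ : R => k) u = (b - a) * k.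
  rewrite Rintegral_cst //=  lebesgue_measure_itv /= lte_fin.
  by case: ltgtP ab => //= [_ _|-> _]; rewrite ?mulr0 ?subrr ?mul0r// mulrC.
have lo : (b - a) * (c - e) <= \int[lebesgue_measure]_(u in `[a, b]) f u.
  rewrite -Icst; apply: le_Rintegral => // u /=; rewrite in_itv /= => /fe.
  by rewrite ler_norml => /andP[]; lra.
have up : \int[lebesgue_measure]_(u in `[a, b]) f u <= (b - a) * (c + e).
  rewrite -Icst; apply: le_Rintegral => // u /=; rewrite in_itv /= => /fe.
  by rewrite ler_norml => /andP[]; lra.
move: lo up; move: (Rintegral _ _ _) => I lo up; clear - lo up.
by rewrite ler_norml; apply/andP; split; lra.
Qed.

(** Bounds the error in the increment of the primitive. For [b < a] the estimate on the reversed
    segment applies, with both signs changed. *)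
Lemma oint_dist (a b e : R) : J a -> J b ->
  (forall u, J u -> `|u - a| <= `|b - a| -> `|f a - f u| <= e) ->
  `|oint a b f - (b - a) * f a| <= `|b - a| * e.
Proof.
move=> Ja Jb fe; rewrite /oint; case: (leP a b) => ab.
  have ab0 : 0 <= b - a by rewrite subr_ge0.
  rewrite (ger0_norm ab0); apply: integral_segment_dist => // u /andP[au ub].
  apply: fe; first by apply: itvJ Ja Jb _ _; rewrite au.
  by rewrite !ger0_norm ?subr_ge0// lerD2r.
have ab0 : b - a < 0 by rewrite subr_lt0.
rewrite (ltr0_norm ab0) opprB.
rewrite -normrN opprB addrC opprK.
have -> : (b - a) * f a = - ((a - b) * f a) by ring.
apply: integral_segment_dist => // [|u /andP[bu ua]]; first exact: ltW.
apply: fe; first by apply: itvJ Jb Ja _ _; rewrite bu.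
by rewrite !ler0_norm ?subr_le0 ?(ltW ab)// lerN2 lerD2r.
Qed.

(** The fundamental theorem of calculus, one-sided at end points of [J]: the increment is the
    integral from [t] to [t + h], where continuity within [J] keeps [f] within [e] of [f t]. *)
Lemma has_partial_oint t0 t : J t0 -> J t ->
  has_partial J (fun u => oint t0 u f) t 1 (f t).
Proof.
move=> Jt0 Jt; rewrite /has_partial; apply/cvgrPdist_le => e e0.
have /subspace_continuousP/(_ _ Jt)/cvgrPdist_le/(_ _ e0) := cf.
rewrite near_withinE => /nbhs_ballP[d /= d0 dP].
rewrite near_withinE.
apply/nbhs_ballP; exists d => //= h; rewrite /ball /= sub0r normrN => hd h0 Jth.
have E : h *: (1 : R) = h by rewrite /GRing.scale /= mulr1.
rewrite /= E in Jth *.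
rewrite (ointD Jt0 Jt Jth) [X in _ * X](_ : _ = oint t (t + h) f); last by ring.
have := @oint_dist t (t + h) e Jt Jth; rewrite [t + h - t](_ : _ = h); last by ring.
move=> /(_ _) H.
have {}H : `|oint t (t + h) f - h * f t| <= `|h| * e.
  apply: H => u Ju uh; apply: dP => //; rewrite /ball /=.
  by rewrite distrC (le_lt_trans uh).
rewrite -(ler_pM2l (x := `|h|)) ?normr_gt0//.
rewrite -normrM mulrBr mulrA divff// mul1r distrC.
exact: H.
Qed.

End PrimitiveOnInterval.

(** * Real and imaginary parts of sums, products and inverses *)

Section ReIm.
Variable R : realType.
Implicit Types z w : R[i].

Lemma ReD z w : complex.Re (z + w) = complex.Re z + complex.Re w.
Proof. by case: z w => [a b] [c d]. Qed.

Lemma ImD z w : complex.Im (z + w) = complex.Im z + complex.Im w.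
Proof. by case: z w => [a b] [c d]. Qed.

Lemma ReM z w : complex.Re (z * w) =
  complex.Re z * complex.Re w - complex.Im z * complex.Im w.
Proof. by case: z w => [a b] [c d]. Qed.

Lemma ImM z w : complex.Im (z * w) =
  complex.Re z * complex.Im w + complex.Im z * complex.Re w.
Proof. by case: z w => [a b] [c d]. Qed.

Lemma Re_sum (I : Type) (r : seq I) (F : I -> R[i]) :
  complex.Re (\sum_(i <- r) F i) = \sum_(i <- r) complex.Re (F i).
Proof. by rewrite (big_morph _ ReD (erefl : complex.Re 0 = 0)). Qed.

Lemma Im_sum (I : Type) (r : seq I) (F : I -> R[i]) :
  complex.Im (\sum_(i <- r) F i) = \sum_(i <- r) complex.Im (F i).
Proof. by rewrite (big_morph _ ImD (erefl : complex.Im 0 = 0)). Qed.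

Lemma ReV z : complex.Re z^-1 =
  complex.Re z * (complex.Re z * complex.Re z + complex.Im z * complex.Im z)^-1.
Proof. by case: z. Qed.

Lemma ImV z : complex.Im z^-1 =
  - (complex.Im z * (complex.Re z * complex.Re z + complex.Im z * complex.Im z)^-1).
Proof. by case: z => a b /=; rewrite !expr2. Qed.

Lemma sqr_norm_neq0 z : z != 0 ->
  complex.Re z * complex.Re z + complex.Im z * complex.Im z != 0.
Proof.
case: z => a b; apply: contra; rewrite eq_complex /= -!expr2.
by rewrite paddr_eq0 ?sqr_ge0// !sqrf_eq0.
Qed.

End ReIm.

(** * Componentwise calculus for complex-valued functions *)

Section ComplexDerivative.
Variables (R : realType) (V : normedModType R).
Implicit Types (f g : V -> R[i]) (x v : V) (l : R[i]).

(** The direction [v] is real, so no holomorphy is involved; the componentwise form matches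
    [cpartial] and [first_integralC]. *)
Definition is_cderive x v f l :=
  is_derive x v (fun y => complex.Re (f y)) (complex.Re l) /\
  is_derive x v (fun y => complex.Im (f y)) (complex.Im l).

Definition ccontinuous_at x f :=
  (complex.Re (f y) @[y --> x] --> complex.Re (f x)) /\
  (complex.Im (f y) @[y --> x] --> complex.Im (f x)).

Lemma is_cderive_cst x v (c : R[i]) : is_cderive x v (fun=> c) 0.
Proof. by split; exact: is_derive_cst. Qed.

Lemma is_cderiveD x v f g k l : is_cderive x v f k -> is_cderive x v g l ->
  is_cderive x v (fun y => f y + g y) (k + l).
Proof.
move=> [f1 f2] [g1 g2]; split.
  under eq_fun do rewrite ReD; rewrite ReD; exact: is_deriveD.
under eq_fun do rewrite ImD; rewrite ImD; exact: is_deriveD.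
Qed.

Lemma is_cderiveM x v f g k l : is_cderive x v f k -> is_cderive x v g l ->
  is_cderive x v (fun y => f y * g y) (k * g x + f x * l).
Proof.
move=> [f1 f2] [g1 g2]; split.
  under eq_fun do rewrite ReM.
  apply: (is_derive_eq (is_deriveB (is_deriveM f1 g1) (is_deriveM f2 g2))).
  by rewrite ReD !ReM /GRing.scale /=; ring.
under eq_fun do rewrite ImM.
apply: (is_derive_eq (is_deriveD (is_deriveM f1 g2) (is_deriveM f2 g1))).
by rewrite ImD !ImM /GRing.scale /=; ring.
Qed.

Lemma is_derive_inv x v (f : V -> R) (l : R) : f x != 0 -> is_derive x v f l ->
  is_derive x v (fun y => (f y)^-1) (- (f x) ^- 2 * l).
Proof.
move=> fx0 [df <-]; split; first exact: derivableV.
by rewrite deriveV.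
Qed.

(** The inverse has real quotients Re f / N and - Im f / N as its parts, where N is the squared
    modulus of [f]; the value is then a rational identity in real coordinates with N nonzero. *)
Lemma is_cderiveV x v f l : f x != 0 -> is_cderive x v f l ->
  is_cderive x v (fun y => (f y)^-1) (- l * ((f x)^-1 * (f x)^-1)).
Proof.
move=> fx0 [f1 f2]; have N0 := sqr_norm_neq0 fx0.
have dN := is_derive_inv (f := fun y => complex.Re (f y) * complex.Re (f y) +
    complex.Im (f y) * complex.Im (f y)) N0 (is_deriveD (is_deriveM f1 f1) (is_deriveM f2 f2)).
split.
  under eq_fun do rewrite ReV.
  apply: (is_derive_eq (is_deriveM f1 dN)).
  clear dN f1 f2 fx0; move: N0; case: (f x) l => [a b] [c d] /= N0; rewrite /GRing.scale /= !expr2.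
  by field.
under eq_fun do rewrite ImV.
apply: (is_derive_eq (is_deriveN (is_deriveM f2 dN))).
clear dN f1 f2 fx0; move: N0; case: (f x) l => [a b] [c d] /= N0; rewrite /GRing.scale /= !expr2.
by field.
Qed.

Lemma ccontinuous_cst x (c : R[i]) : ccontinuous_at x (fun=> c).
Proof. by split; exact: cvg_cst. Qed.

Lemma ccontinuousD x f g : ccontinuous_at x f -> ccontinuous_at x g ->
  ccontinuous_at x (fun y => f y + g y).
Proof.
move=> [f1 f2] [g1 g2]; split.
  under eq_fun do rewrite ReD; rewrite ReD; exact: cvgD.
under eq_fun do rewrite ImD; rewrite ImD; exact: cvgD.
Qed.

Lemma ccontinuousM x f g : ccontinuous_at x f -> ccontinuous_at x g ->
  ccontinuous_at x (fun y => f y * g y).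
Proof.
move=> [f1 f2] [g1 g2]; split.
  under eq_fun do rewrite ReM; rewrite ReM.
  by apply: cvgB; exact: cvgM.
under eq_fun do rewrite ImM; rewrite ImM.
by apply: cvgD; exact: cvgM.
Qed.

Lemma ccontinuousV x f : f x != 0 -> ccontinuous_at x f ->
  ccontinuous_at x (fun y => (f y)^-1).
Proof.
move=> fx0 [f1 f2].
have cN : (complex.Re (f y) * complex.Re (f y) +
    complex.Im (f y) * complex.Im (f y))^-1 @[y --> x] -->
    (complex.Re (f x) * complex.Re (f x) + complex.Im (f x) * complex.Im (f x))^-1.
  by apply: cvgV; [exact: sqr_norm_neq0 | apply: cvgD; exact: cvgM].
split.
  under eq_fun do rewrite ReV; rewrite ReV; exact: cvgM.
under eq_fun do rewrite ImV; rewrite ImV; apply: cvgN; exact: cvgM.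
Qed.

End ComplexDerivative.

Lemma cvg_sumr (R : realType) (T I : Type) (F : set_system T) (r : seq I)
    (f : I -> T -> R) (l : I -> R) : Filter F ->
  (forall i, f i x @[x --> F] --> l i) ->
  \sum_(i <- r) f i x @[x --> F] --> \sum_(i <- r) l i.
Proof.
move=> FF fl; apply: cvg_big => [|i _]; [exact: add_continuous | exact: fl].
Qed.

(** * Linear forms and their derivatives *)

Section LinearForms.
Variables (R : realType) (n : nat).
Implicit Types (nu w : 'cV[R[i]]_n) (x v : 'cV[R]_n) (A : 'M[R]_n).

Lemma linformD nu w x : linform (nu + w) x = linform nu x + linform w x.
Proof.
by rewrite /linform -big_split; apply: eq_bigr => i _; rewrite mxE mulrDl.
Qed.

Lemma linformZ c nu x : linform (c *: nu) x = c * linform nu x.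
Proof.
by rewrite /linform mulr_sumr; apply: eq_bigr => i _; rewrite mxE mulrA.
Qed.

(** This is why the $B_j$ are transposes: $\mathfrak a_j$ sends the form of $\nu$ to that of
    $B_j\nu$, so eigenvectors of $B_j$ give eigenfunctions of $\mathfrak a_j$. *)
Lemma linform_trmxC A nu x : linform (trmxC A *m nu) x = linform nu (A *m x).
Proof.
rewrite /linform.
under eq_bigr do rewrite mxE mulr_suml.
rewrite exchange_big /=; apply: eq_bigr => j _.
rewrite mxE rmorph_sum mulr_sumr; apply: eq_bigr => i _.
by rewrite !mxE rmorphM; ring.
Qed.

Lemma linform_delta nu i : linform nu (delta_mx i 0) = nu i 0.
Proof.
rewrite /linform (bigD1 i) //= big1 => [|j ji]; rewrite mxE.
  by rewrite !eqxx addr0 rmorph1 mulr1.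
by rewrite (negbTE ji) rmorph0 mulr0.
Qed.

Lemma linform_line nu h v x :
  linform nu (h *: v + x) = real_complex R h * linform nu v + linform nu x.
Proof.
rewrite /linform mulr_sumr -big_split; apply: eq_bigr => i _ /=.
by rewrite !mxE rmorphD rmorphM; ring.
Qed.

Lemma Re_linform nu x : complex.Re (linform nu x) =
  \sum_(i < n) complex.Re (nu i 0) * x i 0.
Proof.
rewrite /linform Re_sum.
by apply: eq_bigr => i _; rewrite ReM /= mulr0 subr0.
Qed.

Lemma Im_linform nu x : complex.Im (linform nu x) =
  \sum_(i < n) complex.Im (nu i 0) * x i 0.
Proof.
rewrite /linform Im_sum.
by apply: eq_bigr => i _; rewrite ImM /= mulr0 add0r.
Qed.

Lemma is_derive_affine_line (V : normedModType R) (f : V -> R) (x v : V) (l : R) :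
  (forall h, f (h *: v + x) = h * l + f x) -> is_derive x v f l.
Proof.
move=> fE.
have E : h^-1 *: ((f \o shift x) (h *: v) - f x) @[h --> 0^'] --> l.
  apply: cvg_trans (@cvg_cst _ l _ (0 : R)^' _).
  apply: near_eq_cvg; near=> h.
  have h0 : h != 0 by near: h; exact: nbhs_dnbhs_neq.
  by rewrite /= fE addrK [_ *: _]mulrA mulVf// mul1r.
by split; [apply/cvg_ex; exists l | apply: cvg_lim].
Unshelve. all: by end_near.
Qed.

Lemma is_cderive_linform nu x v : is_cderive x v (linform nu) (linform nu v).
Proof.
split; apply: is_derive_affine_line => h; rewrite linform_line.
  by rewrite ReD ReM /= mul0r subr0.
by rewrite ImD ImM /= mul0r addr0.
Qed.

Lemma ccontinuous_linform nu x : ccontinuous_at x (linform nu).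
Proof.
split.
  under eq_fun do rewrite Re_linform; rewrite Re_linform.
  apply: (cvg_sumr (F := nbhs x)) => i; apply: cvgM; [exact: cvg_cst | exact: coord_continuous].
under eq_fun do rewrite Im_linform; rewrite Im_linform.
apply: (cvg_sumr (F := nbhs x)) => i; apply: cvgM; [exact: cvg_cst | exact: coord_continuous].
Qed.

End LinearForms.

(** * Formal expressions in linear forms and $1/\nu^0x$, with their derivations *)

Section RationalFunctions.
Variables (R : realType) (n : nat) (nu0 : 'cV[R[i]]_n).

(* A deep embedding, so that [rlie] can be iterated and compared without
   proving that second partial derivatives commute. *)
Inductive ratfun : Type :=
| RCst of R[i]
| RLin of 'cV[R[i]]_n
| RInv
| RAdd of ratfun & ratfun
| RMul of ratfun & ratfun.

Fixpoint reval (e : ratfun) (x : 'cV[R]_n) : R[i] :=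
  match e with
  | RCst c => c
  | RLin nu => linform nu x
  | RInv => (linform nu0 x)^-1
  | RAdd e1 e2 => reval e1 x + reval e2 x
  | RMul e1 e2 => reval e1 x * reval e2 x
  end.

(* The derivation of the algebra of [ratfun]s that extends [d], the images of
   the linear forms. *)
Fixpoint rderiv (d : 'cV[R[i]]_n -> ratfun) (e : ratfun) : ratfun :=
  match e with
  | RCst c => RCst 0
  | RLin nu => d nu
  | RInv => RMul (RMul (RCst (-1)) (d nu0)) (RMul RInv RInv)
  | RAdd e1 e2 => RAdd (rderiv d e1) (rderiv d e2)
  | RMul e1 e2 => RAdd (RMul (rderiv d e1) e2) (RMul e1 (rderiv d e2))
  end.

Definition rpartial (v : 'cV[R]_n) : ratfun -> ratfun :=
  rderiv (fun nu => RCst (linform nu v)).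

Definition rlie (A : 'M[R]_n) : ratfun -> ratfun :=
  rderiv (fun nu => RLin (trmxC A *m nu)).

Lemma is_cderive_reval e x v : linform nu0 x != 0 ->
  is_cderive x v (reval e) (reval (rpartial v e) x).
Proof.
move=> x0; elim: e => [c|nu||e1 IH1 e2 IH2|e1 IH1 e2 IH2] /=.
- exact: is_cderive_cst.
- exact: is_cderive_linform.
- rewrite mulN1r; exact: is_cderiveV (is_cderive_linform _ _ _).
- exact: is_cderiveD.
- exact: is_cderiveM.
Qed.

Lemma ccontinuous_reval e x : linform nu0 x != 0 -> ccontinuous_at x (reval e).
Proof.
move=> x0; elim: e => [c|nu||e1 IH1 e2 IH2|e1 IH1 e2 IH2] /=.
- exact: ccontinuous_cst.
- exact: ccontinuous_linform.
- exact: ccontinuousV (ccontinuous_linform _ _).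
- exact: ccontinuousD.
- exact: ccontinuousM.
Qed.

Lemma linform_sum_coord nu x :
  linform nu x = \sum_(i < n) real_complex R (x i 0) * linform nu (delta_mx i 0).
Proof. by apply: eq_bigr => i _; rewrite linform_delta mulrC. Qed.

(** Both sides obey the same sum and product rules in [e], so it is enough that they agree on linear
    forms, where the vector $Ax$ is expanded in coordinates. *)
Lemma reval_rlie A e x : reval (rlie A e) x =
  \sum_(i < n) real_complex R ((A *m x) i 0) * reval (rpartial (delta_mx i 0) e) x.
Proof.
elim: e => [c|nu||e1 IH1 e2 IH2|e1 IH1 e2 IH2] /=.
- by rewrite big1 // => i _; rewrite mulr0.
- by rewrite linform_trmxC linform_sum_coord.
- rewrite linform_trmxC linform_sum_coord mulr_sumr mulr_suml.
  by apply: eq_bigr => i _; ring.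
- by rewrite IH1 IH2 -big_split; apply: eq_bigr => i _; rewrite mulrDr.
- rewrite IH1 IH2 mulr_suml mulr_sumr -big_split; apply: eq_bigr => i _ /=; ring.
Qed.

(** The commutator of two derivations is a derivation, and on linear forms it vanishes because [A]
    and [B] commute. *)
Lemma reval_rlieC A B e x : A *m B = B *m A ->
  reval (rlie A (rlie B e)) x = reval (rlie B (rlie A e)) x.
Proof.
move=> AB; elim: e => [c|nu||e1 IH1 e2 IH2|e1 IH1 e2 IH2].
- by [].
- by rewrite /= !linform_trmxC !mulmxA AB.
- by rewrite /= !linform_trmxC !mulmxA AB; ring.
- by congr (_ + _).
(* The two mixed terms exchange places when [C] and [D] do, so only the second derivatives of each
   factor have to be compared. *)
- have E C D : reval (rlie C (rlie D (RMul e1 e2))) x =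
      reval (rlie C (rlie D e1)) x * reval e2 x +
      reval (rlie D e1) x * reval (rlie C e2) x +
      (reval (rlie C e1) x * reval (rlie D e2) x +
       reval e1 x * reval (rlie C (rlie D e2)) x) by [].
  by rewrite !E IH1 IH2; ring.
Qed.

Lemma is_cderive_eq_on (X : set 'cV[R]_n) (f g : 'cV[R]_n -> R[i]) x v l :
  open X -> X x -> {in X, f =1 g} -> is_cderive x v g l -> is_cderive x v f l.
Proof.
move=> oX Xx fg [g1 g2]; split.
  apply: near_eq_is_derive g1; near=> y; rewrite fg// inE.
  by near: y; exact: open_nbhs_nbhs.
apply: near_eq_is_derive g2; near=> y; rewrite fg// inE.
by near: y; exact: open_nbhs_nbhs.
Unshelve. all: by end_near.
Qed.

Lemma cpartialE (i : 'I_n) (f : 'cV[R]_n -> R[i]) x l :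
  is_cderive x (delta_mx i 0) f l -> cpartial i f x = l.
Proof. by rewrite /cpartial; case: l => a b [[_ /= ->] [_ /= ->]]. Qed.

Lemma lie_op_reval (X : set 'cV[R]_n) A f e x : open X ->
  X `<=` [set y | linform nu0 y != 0] -> {in X, f =1 reval e} -> X x ->
  lie_op A f x = reval (rlie A e) x.
Proof.
move=> oX X0 fe Xx; rewrite reval_rlie; apply: eq_bigr => i _.
rewrite (cpartialE (is_cderive_eq_on oX Xx fe (is_cderive_reval _ _ _)))//.
exact: X0.
Qed.

(** [rlie] acts on expressions, not on functions. On an open set its values depend only on the
    function represented, since they are those of [lie_op]; identities between functions may
    therefore be derived formally. *)
Lemma eq_reval_rlie (X : set 'cV[R]_n) A e1 e2 : open X ->
  X `<=` [set y | linform nu0 y != 0] -> {in X, reval e1 =1 reval e2} ->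
  {in X, reval (rlie A e1) =1 reval (rlie A e2)}.
Proof.
move=> oX X0 e12 x /set_mem Xx.
rewrite -(lie_op_reval A (f := reval e1) oX X0 _ Xx)//.
by rewrite (lie_op_reval A oX X0 e12 Xx).
Qed.

End RationalFunctions.

Arguments RInv {R n}.
Arguments RCst {R n}.

(** * Solving and differentiating the functional system *)

Section FunctionalSystem.
Variables (R : realType) (n s : nat) (nu : nat -> 'cV[R[i]]_n).
Variables (X : set 'cV[R]_n) (Psi : nat -> 'cV[R]_n -> R[i]).
Hypotheses (oX : open X) (X0 : X `<=` [set x | linform (nu 0%N) x != 0]).
Hypothesis hPsi : forall theta, (1 <= theta < s)%N -> forall x, X x ->
  linform (nu theta) x =
    \sum_(1 <= rho < theta.+1)
      'C(theta.-1, rho.-1)%:R * Psi rho x * linform (nu (theta - rho)%N) x.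

Lemma ratfun_sum (r : seq nat) (f : nat -> 'cV[R]_n -> R[i]) :
  (forall i, i \in r -> exists e : ratfun R n, {in X, f i =1 reval (nu 0%N) e}) ->
  exists e : ratfun R n, {in X, (fun x => \sum_(i <- r) f i x) =1 reval (nu 0%N) e}.
Proof.
elim: r => [_|i r IH fr].
  by exists (RCst 0) => x _ /=; rewrite big_nil.
have [e1 He1] := fr i (mem_head _ _).
have [|e2 He2] := IH; first by move=> j jr; apply: fr; rewrite inE jr orbT.
by exists (RAdd e1 e2) => x Xx /=; rewrite big_cons He1// He2.
Qed.

(** Strong induction: in the equation of order [theta], the last summand is $\Psi_\theta(x)\,\nu^0x$
    and the others involve only earlier [Psi rho], so division by $\nu^0x$ solves for
    [Psi theta]. *)
Lemma Psi_ratfun theta : (1 <= theta < s)%N ->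
  exists e : ratfun R n, {in X, Psi theta =1 reval (nu 0%N) e}.
Proof.
elim/ltn_ind: theta => theta IH hth; have /andP[th1 ths] := hth.
have [|eS HeS] := @ratfun_sum (index_iota 1 theta)
  (fun rho x => 'C(theta.-1, rho.-1)%:R * Psi rho x * linform (nu (theta - rho)%N) x).
  move=> rho; rewrite mem_index_iota => /andP[r1 rt].
  have [|e He] := IH rho rt; first by rewrite r1 (ltn_trans rt).
  exists (RMul (RMul (RCst 'C(theta.-1, rho.-1)%:R) e) (RLin (nu (theta - rho)%N))).
  by move=> x Xx /=; rewrite He.
exists (RMul (RAdd (RLin (nu theta)) (RMul (RCst (-1)) eS)) RInv) => x Xx /=.
have Lx := X0 (set_mem Xx); have := hPsi hth (set_mem Xx).
rewrite big_nat_recr //= subnn binn mul1r -HeS// => ->.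
by rewrite mulN1r addrAC subrr add0r mulfK.
Qed.

Variables (A : 'M[R]_n) (l : R[i]).
(** The case [k = 0] is the eigenvector equation: the factor [k%:R] kills the term with [0.-1],
    which is [0]. *)
Hypothesis hnu : forall k, (k < s)%N ->
  trmxC A *m nu k = l *: nu k + k%:R *: nu k.-1.

Lemma linform_nu k x : (k < s)%N -> linform (trmxC A *m nu k) x =
  l * linform (nu k) x + k%:R * linform (nu k.-1) x.
Proof. by move=> ks; rewrite hnu// linformD !linformZ. Qed.

(* Applying the derivation along [A] to the functional system of order [theta]
   and subtracting [l] times that system and [theta.-1] times the one of order
   [theta.-1] leaves a triangular system for the derivatives of the [Psi rho]. *)
Lemma lie_functional_system (e : nat -> ratfun R n) theta x :
  (forall rho, (1 <= rho < s)%N -> {in X, Psi rho =1 reval (nu 0%N) (e rho)}) ->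
  (1 <= theta < s)%N -> X x ->
  linform (nu theta.-1) x =
    \sum_(1 <= rho < theta.+1) 'C(theta.-1, rho.-1)%:R *
      reval (nu 0%N) (rlie (nu 0%N) A (e rho)) x * linform (nu (theta - rho)%N) x.
Proof.
move=> He hth Xx; have /andP[th1 ths] := hth.
pose T rho : ratfun R n := RMul (RMul (RCst 'C(theta.-1, rho.-1)%:R) (e rho))
  (RLin (nu (theta - rho)%N)).
pose S := \big[@RAdd R n/RCst 0]_(1 <= rho < theta.+1) T rho.
have SE y : reval (nu 0%N) S y = \sum_(1 <= rho < theta.+1) reval (nu 0%N) (T rho) y.
  exact: (big_morph (fun e => reval (nu 0%N) e y)).
have dSE y : reval (nu 0%N) (rlie (nu 0%N) A S) y = \sum_(1 <= rho < theta.+1) reval (nu 0%N) (rlie (nu 0%N) A (T rho)) y.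
  exact: (big_morph (fun e => reval (nu 0%N) (rlie (nu 0%N) A e) y)).
(* The functional system becomes an equality of values of two expressions, to which [rlie] may be
   applied. *)
have eqS : {in X, reval (nu 0%N) (RLin (nu theta)) =1 reval (nu 0%N) S}.
  move=> y /set_mem Xy; rewrite SE /= hPsi//; apply: eq_big_nat => rho /andP[r1 rt].
  by rewrite (He rho) ?inE// r1 (leq_trans rt).
have := eq_reval_rlie A oX X0 eqS (mem_set Xx).
rewrite dSE /= linform_nu//.
(* By the product rule each [T rho] yields the wanted term, [l] times itself, and [theta - rho]
   times a term with [nu (theta - rho).-1]; the last two kinds add up to the systems of orders
   [theta] and [theta.-1]. *)
have -> : \sum_(1 <= rho < theta.+1) reval (nu 0%N) (rlie (nu 0%N) A (T rho)) x =
    \sum_(1 <= rho < theta.+1) 'C(theta.-1, rho.-1)%:R *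
      reval (nu 0%N) (rlie (nu 0%N) A (e rho)) x * linform (nu (theta - rho)%N) x +
    l * linform (nu theta) x + theta.-1%:R * linform (nu theta.-1) x.
  rewrite (hPsi hth Xx) mulr_sumr -big_split /=.
  (* The system of order [theta.-1] is extended to the range of order [theta]. The added summand
     vanishes: by its binomial if [theta > 1], by the factor [theta.-1] if [theta = 1]. *)
  have -> : theta.-1%:R * linform (nu theta.-1) x =
      \sum_(1 <= rho < theta.+1) theta.-1%:R * 'C(theta.-2, rho.-1)%:R *
        reval (nu 0%N) (e rho) x * linform (nu (theta - rho).-1) x.
    rewrite big_nat_recr //=.
    have [->|th2] := eqVneq theta 1%N.
      by rewrite big_geq// !mul0r addr0.
    have {}th2 : (1 < theta)%N by rewrite ltn_neqAle eq_sym th2.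
    rewrite bin_small; last by case: theta th2 {hth th1 ths T S SE dSE eqS} => [|[]].
    rewrite mulr0 !mul0r addr0.
    rewrite hPsi //; last by rewrite -ltnS prednK// th2 ltnW.
    rewrite prednK// mulr_sumr; apply: eq_big_nat => rho /andP[r1 rt].
    rewrite (He rho) ?inE// ?r1 ?(ltn_trans rt)//.
    have -> : (theta - rho).-1 = (theta.-1 - rho)%N by rewrite -subn1 -[RHS]/(_) subnAC subn1.
    by rewrite !mulrA.
  rewrite -big_split /=; apply: eq_big_nat => rho /andP[r1 rt].
  rewrite linform_nu; last by rewrite (leq_ltn_trans (leq_subr _ _)).
  rewrite (He rho) ?inE// ?r1 ?(leq_trans rt)//.
  (* With N = theta - 1 and r = rho - 1, the identity $N\binom{N-1}{r}=(N-r)\binom{N}{r}$ matches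
     the factor [theta - rho] coming from the generalized eigenvectors. *)
  rewrite -(natrM _ theta.-1) mul_bin_down natrM.
  have -> : (theta.-1 - rho.-1 = theta - rho)%N by case: theta rho th1 r1 {hth ths T S SE dSE eqS rt} => [|?] [].
  ring.
(* Of the [theta] copies of $\nu^{\theta-1}x$ on the left, [theta.-1] cancel and one remains. *)
have -> : theta%:R = theta.-1%:R + 1 :> R[i] by rewrite -[in LHS](prednK th1) -natr1.
rewrite mulrDl mul1r => E.
apply: (addrI (l * linform (nu theta) x + theta.-1%:R * linform (nu theta.-1) x)).
by rewrite -addrA E; ring.
Qed.

(** Strong induction on the triangular system: for [theta > 1] the summand [rho = 1] already equals
    the left side and the intermediate ones vanish, so the last, a multiple of $\nu^0x\neq0$, has
    coefficient zero. *)
Lemma lie_Psi (e : nat -> ratfun R n) theta :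
  (forall rho, (1 <= rho < s)%N -> {in X, Psi rho =1 reval (nu 0%N) (e rho)}) ->
  (1 <= theta < s)%N -> {in X, reval (nu 0%N) (rlie (nu 0%N) A (e theta)) =1 fun=> (theta == 1%N)%:R}.
Proof.
move=> He hth x xX; move: xX (xX) => _ /set_mem Xx.
have Lx := X0 Xx.
elim/ltn_ind: theta hth => theta IH hth; have /andP[th1 ths] := hth.
have := lie_functional_system He hth Xx.
rewrite big_nat_recr //= subnn binn mul1r.
have [E|th2] := eqVneq theta 1%N.
  rewrite E big_geq// add0r => H.
  by apply: (mulIf Lx); rewrite -H mul1r.
have {}th2 : (1 < theta)%N by rewrite ltn_neqAle eq_sym th2.
rewrite big_ltn// IH// ?(ltn_trans _ ths)//= bin0 !mul1r subn1.
rewrite big_nat big1 => [|rho /andP[r1 rt]].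
  rewrite addr0 => /eqP; rewrite addrC -subr_eq subrr eq_sym mulf_eq0 (negbTE Lx) orbF.
  by move=> /eqP.
have hr : (1 <= rho < s)%N by rewrite (ltnW r1) (ltn_trans rt).
by rewrite IH// (gtn_eqF r1) mulr0 mul0r.
Qed.

End FunctionalSystem.

(** * First integrals with separated variables *)

Section FirstIntegrals.
Variables (R : realType) (n : nat) (J : set R) (X : set 'cV[R]_n).
Variable V : R -> 'cV[R]_n -> 'cV[R]_n.

Lemma within_continuous_fst (f : R -> R) : {within J, continuous f} ->
  {within J `*` X, continuous (fun p => f p.1)}.
Proof.
move=> /subspace_continuousP cf; apply/subspace_continuousP => -[t x] [/= Jt Xx].
apply: (cvg_comp _ _ _ (cf t Jt)).
move=> B; rewrite /= !near_simpl /within /= => HB.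
have : \forall p \near (t, x), J p.1 -> B p.1 by exact: cvg_fst HB.
by apply: filterS => p HJ [/HJ].
Qed.

Lemma within_continuous_snd (f : 'cV[R]_n -> R) :
  (forall x, X x -> f y @[y --> x] --> f x) ->
  {within J `*` X, continuous (fun p => f p.2)}.
Proof.
move=> cf; apply/subspace_continuousP => -[t x] [/= Jt Xx].
apply: cvg_within_filter.
exact: (cvg_comp _ _ cvg_snd (cf x Xx)).
Qed.

(** For $g(x)-G(t)$ the defining equation says that the derivative of [g] along [V] is $G'(t)$. Only
    the derivative in [t] needs the one-sided notion. *)
Lemma first_integral_sub (g : 'cV[R]_n -> R) (gx : 'I_n -> 'cV[R]_n -> R)
    (G G' : R -> R) :
  (forall x i, X x -> is_derive x (delta_mx i 0 : 'cV[R]_n) g (gx i x)) ->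
  (forall i x, X x -> gx i y @[y --> x] --> gx i x) ->
  (forall t, J t -> has_partial J G t 1 (G' t)) ->
  {within J, continuous G'} ->
  (forall t x, J t -> X x -> \sum_(i < n) V t x i 0 * gx i x = G' t) ->
  first_integral (J `*` X) V (fun p => g p.2 - G p.1).
Proof.
move=> dg cg dG cG eqV.
exists (fun p => - G' p.1), (fun i p => gx i p.2); split.
- apply: (@within_continuous_fst (fun t => - G' t)).
  move/subspace_continuousP: cG => cG; apply/subspace_continuousP => t Jt.
  by apply: cvgN; exact: cG.
- by move=> i; exact: within_continuous_snd (cg i).
- move=> [t x] [/= Jt Xx]; rewrite /has_partial.
  have E1 : [set h : R | (J `*` X) ((t, x) + h *: (1, 0))] = [set h | J (t + h *: 1)].
    by apply/seteqP; split => h /=; rewrite /= scaler0 addr0; [case | split].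
  rewrite E1.
  rewrite [X in X @ _](_ : _ = fun h => - (h^-1 * (G (t + h *: 1) - G t))).
    by apply: cvgN; exact: dG.
  by apply/funext => h /=; rewrite scaler0 addr0; ring.
- move=> [t x] i [/= Jt Xx]; rewrite /has_partial; apply: cvg_within_filter.
  rewrite [X in X @ _](_ : _ = fun h => h^-1 *: ((g \o shift x) (h *: delta_mx i 0) - g x)).
    by have [dgx <-] := dg x i Xx; exact: dgx.
  by apply/funext => h /=; rewrite scaler0 addr0 (addrC x) /GRing.scale /=; ring.
- by move=> [t x] [/= Jt Xx]; rewrite eqV// addNr.
Qed.

(** Serves twice: with [G = 0] for the autonomous system of hypothesis (iii), and with the integral
    term for the full system. *)
Lemma first_integralC_ratfun (nu0 : 'cV[R[i]]_n) (f : 'cV[R]_n -> R[i])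
    (e : ratfun R n) (G G' : R -> R[i]) :
  open X -> X `<=` [set x | linform nu0 x != 0] -> {in X, f =1 reval nu0 e} ->
  (forall t, J t -> has_partial J (fun u => complex.Re (G u)) t 1 (complex.Re (G' t))) ->
  (forall t, J t -> has_partial J (fun u => complex.Im (G u)) t 1 (complex.Im (G' t))) ->
  {within J, continuous (fun t => complex.Re (G' t))} ->
  {within J, continuous (fun t => complex.Im (G' t))} ->
  (forall t x, J t -> X x -> \sum_(i < n) real_complex R (V t x i 0) *
     reval nu0 (rpartial nu0 (delta_mx i 0) e) x = G' t) ->
  first_integralC (J `*` X) V (fun p => f p.2 - G p.1).
Proof.
move=> oX X0 fe dG1 dG2 cG1 cG2 eqV.
have df x i : X x -> is_cderive x (delta_mx i 0 : 'cV[R]_n) f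
    (reval nu0 (rpartial nu0 (delta_mx i 0) e) x).
  move=> Xx; apply: (is_cderive_eq_on oX Xx fe).
  by apply: is_cderive_reval; exact: X0.
have cf i x : X x -> ccontinuous_at x (reval nu0 (rpartial nu0 (delta_mx i 0) e)).
  by move=> Xx; apply: ccontinuous_reval; exact: X0.
split.
- rewrite [X in first_integral _ _ X](_ : _ =
      fun p => complex.Re (f p.2) - complex.Re (G p.1)); last first.
    by apply/funext => p; rewrite ReD; case: (G p.1).
  apply: (first_integral_sub (g := fun x => complex.Re (f x))
    (G := fun t => complex.Re (G t))
    (fun x i Xx => (df x i Xx).1) (fun i x Xx => (cf i x Xx).1) dG1 cG1).
  move=> t x Jt Xx; rewrite -(eqV t x)// Re_sum.
  by apply: eq_bigr => i _; rewrite ReM /= mul0r subr0.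
- rewrite [X in first_integral _ _ X](_ : _ =
      fun p => complex.Im (f p.2) - complex.Im (G p.1)); last first.
    by apply/funext => p; rewrite ImD; case: (G p.1).
  apply: (first_integral_sub (g := fun x => complex.Im (f x))
    (G := fun t => complex.Im (G t))
    (fun x i Xx => (df x i Xx).2) (fun i x Xx => (cf i x Xx).2) dG2 cG2).
  move=> t x Jt Xx; rewrite -(eqV t x)// Im_sum.
  by apply: eq_bigr => i _; rewrite ImM /= mul0r addr0.
Qed.

End FirstIntegrals.

(** * Constancy of the coefficients [mu] and the first integrals of the full system *)

Unset Implicit Arguments.
Set Strict Implicit.
Set Printing Implicit Defensive.

Theorem theorem2p7 (R : realType) (n m : nat)
  (J : set R) (alpha : 'I_m -> R -> R) (A : 'I_m -> 'M[R]_n)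
  (zeta : 'I_m) (s : nat)
  (lambda : 'I_m -> R[i]) (nu : nat -> 'cV[R[i]]_n)
  (X : set 'cV[R]_n) (Psi : nat -> 'cV[R]_n -> R[i])
  (hJ : is_interval J)
  (halpha_cont : forall j, {within J, continuous (alpha j)})
  (halpha_indep : lin_indep_on J alpha)
  (hA : forall i j, A i *m A j = A j *m A i)
  (hs : (2 <= s)%N)
  (hnu0_neq0 : nu 0%N != 0)
  (hnu0 : forall j, trmxC (A j) *m nu 0%N = lambda j *: nu 0%N)
  (hdiv : has_elementary_divisor (trmxC (A zeta)) (lambda zeta) s)
  (hnu_neq0 : forall theta, (1 <= theta < s)%N -> nu theta != 0)
  (hnu : forall theta, (1 <= theta < s)%N ->
     (trmxC (A zeta) - (lambda zeta)%:M) *m nu theta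
       = theta%:R *: nu theta.-1)
  (hX : is_domain X)
  (hX0 : X `<=` [set x | linform (nu 0%N) x != 0])
  (hPsi : forall theta, (1 <= theta < s)%N -> forall x, X x ->
     linform (nu theta) x =
       \sum_(1 <= rho < theta.+1)
          'C(theta.-1, rho.-1)%:R * Psi rho x * linform (nu (theta - rho)%N) x)
  (hno : forall j theta, j != zeta -> (1 <= theta < s)%N ->
     ~ nonconst_autonomous_first_integral X (A zeta) (lie_op (A j) (Psi theta))) :
  exists mu : 'I_m -> nat -> R[i],
    [/\ forall j theta x, (1 <= theta < s)%N -> X x ->
          lie_op (A j) (Psi theta) x = mu j theta,
        mu zeta 1%N = 1,
        forall theta, (2 <= theta < s)%N -> mu zeta theta = 0 &
        forall t0, J t0 -> forall theta, (1 <= theta < s)%N ->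
          first_integralC (J `*` X)
            (fun t x => \sum_(j < m) alpha j t *: (A j *m x))
            (fun p => Psi theta p.2 -
               ointC t0 p.1 (fun tau =>
                 \sum_(j < m) mu j theta * real_complex R (alpha j tau)))].
Proof.
have [oX _] := hX.
have hnuA k : (k < s)%N -> trmxC (A zeta) *m nu k =
    lambda zeta *: nu k + k%:R *: nu k.-1.
  case: k => [|k] ks; first by rewrite hnu0 scale0r addr0.
  have := hnu k.+1; rewrite ks => /(_ isT); rewrite mulmxBl mul_scalar_mx => <-.
  by rewrite addrC subrK.
have /choice[e He] : forall rho, exists e : ratfun R n, (1 <= rho < s)%N ->
    {in X, Psi rho =1 reval (nu 0%N) e}.
  move=> rho; have [hr|hr] := boolP (1 <= rho < s)%N.
    by have [e He] := Psi_ratfun hX0 hPsi hr; exists e.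
  (* An arbitrary value outside the range of [theta], so that choice gives a total [e]. *)
  by exists RInv.
have lieE j theta x : (1 <= theta < s)%N -> X x ->
    lie_op (A j) (Psi theta) x = reval (nu 0%N) (rlie (nu 0%N) (A j) (e theta)) x.
  by move=> hth Xx; apply: (lie_op_reval (A j) oX hX0 (He _ hth) Xx).
have lie_zeta theta x : (1 <= theta < s)%N -> X x ->
    lie_op (A zeta) (Psi theta) x = (theta == 1%N)%:R.
  move=> hth Xx; rewrite lieE//.
  by apply: (lie_Psi oX hX0 hPsi hnuA He hth); rewrite inE.
have lie_cst j theta x y : j != zeta -> (1 <= theta < s)%N -> X x -> X y ->
    lie_op (A j) (Psi theta) x = lie_op (A j) (Psi theta) y.
  (* Two distinct values would make $\mathfrak a_j\Psi_\theta$ a non-constant first integral,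
     contrary to [hno]. *)
  move=> jz hth Xx Xy; apply: contrapT => neq.
  apply: (hno _ _ jz hth); split; last by exists x, y.
  have := @first_integralC_ratfun R n [set: R] X (fun _ x => A zeta *m x) (nu 0%N)
    (lie_op (A j) (Psi theta)) (rlie (nu 0%N) (A j) (e theta))
    (fun=> 0) (fun=> 0) oX hX0.
  under [X in first_integralC _ _ X]eq_fun do rewrite subr0.
  apply.
  - by move=> z /set_mem Xz; exact: lieE.
  - move=> t _; rewrite /has_partial /= subrr; under eq_fun do rewrite mulr0; exact: cvg_cst.
  - move=> t _; rewrite /has_partial /= subrr; under eq_fun do rewrite mulr0; exact: cvg_cst.
  - by apply: continuous_subspaceT => t; exact: cvg_cst.
  - by apply: continuous_subspaceT => t; exact: cvg_cst.
  (* After exchanging the operators, $\mathfrak a_\zeta\Psi_\theta$ may be replaced by a constant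
     expression, which [rlie] sends to 0. *)
  - move=> _ z _ Xz; rewrite -reval_rlie (reval_rlieC _ _ _ (hA zeta j)).
    have cstz : {in X, reval (nu 0%N) (rlie (nu 0%N) (A zeta) (e theta)) =1
        reval (nu 0%N) (RCst (theta == 1%N)%:R)}.
      by move=> w /set_mem Xw; rewrite -lieE// lie_zeta.
    by rewrite (eq_reval_rlie (A j) oX hX0 cstz) ?inE.
(* At [zeta] the values are explicit, so the normalisation holds even for empty [X]; elsewhere [mu]
   is the value at a chosen point, and the default [0] of [xget] occurs only for empty [X]. *)
pose mu j theta := if j == zeta then (theta == 1%N)%:R
  else lie_op (A j) (Psi theta) (xget 0 X).
have muE j theta x : (1 <= theta < s)%N -> X x ->
    lie_op (A j) (Psi theta) x = mu j theta.
  move=> hth Xx; rewrite /mu; have [->|jz] := eqVneq j zeta; first exact: lie_zeta.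
  by apply: lie_cst => //; exact: (xgetPex 0 (ex_intro _ x Xx)).
exists mu; split => //; first by rewrite /mu eqxx.
  by move=> theta /andP[th2 _]; rewrite /mu eqxx gtn_eqF.
move=> t0 Jt0 theta hth.
(* As the [alpha j] are real, both parts of the integrand are real linear combinations of them,
   hence continuous within [J]. *)
have cRe : {within J, continuous (fun t => complex.Re
    (\sum_(j < m) mu j theta * real_complex R (alpha j t)))}.
  have -> : (fun t => complex.Re (\sum_(j < m) mu j theta * real_complex R (alpha j t))) =
      (fun t => \sum_(j < m) complex.Re (mu j theta) * alpha j t).
    apply/funext => t; rewrite Re_sum; apply: eq_bigr => j _.
    by rewrite ReM /= mulr0 subr0.
  apply/subspace_continuousP => t Jt; apply: cvg_sumr => j.
  apply: cvgM; first exact: cvg_cst.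
  by have /subspace_continuousP := halpha_cont j; exact.
have cIm : {within J, continuous (fun t => complex.Im
    (\sum_(j < m) mu j theta * real_complex R (alpha j t)))}.
  have -> : (fun t => complex.Im (\sum_(j < m) mu j theta * real_complex R (alpha j t))) =
      (fun t => \sum_(j < m) complex.Im (mu j theta) * alpha j t).
    apply/funext => t; rewrite Im_sum; apply: eq_bigr => j _.
    by rewrite ImM /= mulr0 add0r.
  apply/subspace_continuousP => t Jt; apply: cvg_sumr => j.
  apply: cvgM; first exact: cvg_cst.
  by have /subspace_continuousP := halpha_cont j; exact.
apply: (@first_integralC_ratfun R n J X _ (nu 0%N) _ (e theta)
  (fun t => ointC t0 t (fun tau => \sum_(j < m) mu j theta * real_complex R (alpha j tau)))
  _ oX hX0 (He _ hth) _ _ cRe cIm).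
- by move=> t Jt; exact: (has_partial_oint hJ cRe Jt0 Jt).
- by move=> t Jt; exact: (has_partial_oint hJ cIm Jt0 Jt).
move=> t x Jt Xx.
(* Once the sums over coordinates and over [j] are exchanged, the inner sum is [alpha j t] times
   $\mathfrak a_j\Psi_\theta=\mu_\theta^{j\zeta}$. *)
under eq_bigr do rewrite summxE rmorph_sum mulr_suml.
rewrite exchange_big /=; apply: eq_bigr => j _.
rewrite -(muE j theta x hth Xx) lieE// reval_rlie mulr_suml.
by apply: eq_bigr => i _; rewrite mxE rmorphM; ring.
Qed.
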